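(* Let $M\in\mathbb{R}^{m\times m}$ be a symmetric matrix with eigenvalues $\lambda_1,\dots,\lambda_m$ and largest eigenvalue $\lambda_{\max}>0$, and let $1\le d\le m$. Then for all $t\in\left(0,\frac{1}{2\lambda_{\max}}\right)$, $$P_r\left(M|_D\succeq 0\right)\le\prod_{i=1}^m(1-2t\lambda_i)^{-\frac d2},$$ where $D$ is a random $d$-dimensional linear subspace of $\mathbb{R}^m$ distributed according to the Haar probability measure on the Grassmannian $G_r(d,m)$, and $M|_D$ is the restriction of $M$ to $D$.
   Context: $G_r(d,m)$ is the Grassmannian of $d$-dimensional linear subspaces of $\mathbb{R}^m$, i.e. the quotient $O(m)/(O(d)\times O(m-d))$. Its Haar probability measure $P_r$ is the $O(m)$-invariant probability measure induced from the Haar probability measure of the orthogonal group $O(m)$. $M|_D\succeq 0$ means $v^TMv\ge 0$ for all $v\in D$; equivalently $F^TMF$ is positive semidefinite for any $m\times d$ matrix $F$ whose columns form a basis of $D$. *)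

(* Defs.v *)
From HB Require Import structures.
From mathcomp Require Import all_boot all_order all_algebra.
From mathcomp Require Import all_classical all_reals all_analysis.

Set Implicit Arguments.
Unset Strict Implicit.
Unset Printing Implicit Defensive.

Import Order.TTheory GRing.Theory Num.Theory.
Import numFieldNormedType.Exports.

Local Open Scope classical_set_scope.
Local Open Scope ring_scope.

Section orthogonal_group_def.
Context (R : realType) (m : nat).

Record orthogonal_group := Orthogonal {
  orthogonal_mx :> 'M[R]_m ;
  orthogonalP : orthogonal_mx^T *m orthogonal_mx == 1%:M }.

HB.instance Definition _ := [isSub for orthogonal_mx].
HB.instance Definition _ := [Choice of orthogonal_group by <:].

Implicit Types Q : orthogonal_group.

Lemma orthogonal_trmxK Q : Q^T *m Q = 1%:M.
Proof. exact/eqP/orthogonalP. Qed.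

Lemma orthogonal_mxK Q : Q *m Q^T = 1%:M.
Proof. exact/mulmx1C/orthogonal_trmxK. Qed.

Fact orthogonal1_subproof : (1%:M : 'M[R]_m)^T *m 1%:M == 1%:M.
Proof. by rewrite mulmx1 trmx1. Qed.
Definition orthogonal1 := Orthogonal orthogonal1_subproof.

Fact orthogonalM_subproof Q1 Q2 : (Q1 *m Q2)^T *m (Q1 *m Q2) == 1%:M.
Proof.
by rewrite trmx_mul mulmxA -(mulmxA _ Q1^T) orthogonal_trmxK mulmx1
  orthogonal_trmxK.
Qed.
Definition orthogonalM Q1 Q2 := Orthogonal (orthogonalM_subproof Q1 Q2).

Fact orthogonalV_subproof Q : (Q^T)^T *m Q^T == 1%:M.
Proof. by rewrite trmxK orthogonal_mxK. Qed.
Definition orthogonalV Q := Orthogonal (orthogonalV_subproof Q).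

Fact orthogonalMA : associative orthogonalM.
Proof. by move=> Q1 Q2 Q3; apply/val_inj; rewrite /= mulmxA. Qed.

Fact orthogonal1M : left_id orthogonal1 orthogonalM.
Proof. by move=> Q; apply/val_inj; rewrite /= mul1mx. Qed.

Fact orthogonalM1 : right_id orthogonal1 orthogonalM.
Proof. by move=> Q; apply/val_inj; rewrite /= mulmx1. Qed.

Fact orthogonalVM : left_inverse orthogonal1 orthogonalV orthogonalM.
Proof. by move=> Q; apply/val_inj; rewrite /= orthogonal_trmxK. Qed.

Fact orthogonalMV : right_inverse orthogonal1 orthogonalV orthogonalM.
Proof. by move=> Q; apply/val_inj; rewrite /= orthogonal_mxK. Qed.

HB.instance Definition _ := isGroup.Build orthogonal_group
  orthogonalMA orthogonal1M orthogonalM1 orthogonalVM orthogonalMV.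

HB.instance Definition _ := isPointed.Build orthogonal_group orthogonal1.

HB.instance Definition _ :=
  Topological.copy orthogonal_group (initial_topology orthogonal_mx).

HB.instance Definition _ :=
  Measurable.copy orthogonal_group
    (g_sigma_algebraType (@open orthogonal_group)).

End orthogonal_group_def.

(* The orthogonal group is compact, so its left Haar probability measure is
   unique and also right invariant. *)
Definition is_haar (R : realType) (m : nat)
    (mu : probability (orthogonal_group R m) R) :=
  forall (Q : orthogonal_group R m) (A : set (orthogonal_group R m)),
    measurable A -> mu [set (Q * X)%g | X in A] = mu A.

(* The proof of [d <= m] is a parameter because the topology below refers to
   the span of the first [d] columns of an [m x m] matrix. *)
Record grassmannian (R : realType) (d m : nat) (hdm : (d <= m)%N) :=
  Grassmannian {
    grassmannian_space :> {vspace 'cV[R]_m} ;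
    grassmannian_dim : \dim grassmannian_space == d }.

Section grassmannian.
Context (R : realType) (d m : nat) (hdm : (d <= m)%N).
Local Notation Gr := (grassmannian R hdm).

HB.instance Definition _ := [isSub for @grassmannian_space R d m hdm].
HB.instance Definition _ := [Choice of Gr by <:].

Definition frame_span (Q : orthogonal_group R m) : {vspace 'cV[R]_m} :=
  <<[tuple col (widen_ord hdm j) (orthogonal_mx Q) | j < d]>>%VS.

Fact dim_frame_span Q : \dim (frame_span Q) == d.
Proof.
set X := [tuple col (widen_ord hdm j) (orthogonal_mx Q) | j < d].
suff /eqnP : free X by rewrite size_tuple => /eqP.
apply/freeP => k k0 i.
have E (j : 'I_d) : ((col (widen_ord hdm i) (orthogonal_mx Q))^T
    *m col (widen_ord hdm j) (orthogonal_mx Q)) 0 0 = (i == j)%:R.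
  transitivity ((Q^T *m Q) (widen_ord hdm i) (widen_ord hdm j)).
    by rewrite !mxE; apply: eq_bigr => l _; rewrite !mxE.
  by rewrite orthogonal_trmxK mxE.
have := congr1 (mulmx (col (widen_ord hdm i) (orthogonal_mx Q))^T) k0.
rewrite mulmx0 mulmx_sumr => /matrixP/(_ 0 0).
rewrite summxE mxE (bigD1 i) //= big1 => [|j ji];
  rewrite /X /= (nth_map i) ?size_enum_ord // nth_ord_enum -scalemxAr mxE E;
  first by rewrite eqxx mulr1 addr0.
by rewrite eq_sym (negbTE ji) mulr0.
Qed.

(* The fibres of this map are the left cosets of [O(d) x O(m - d)]. *)
Definition grassmannian_pi (Q : orthogonal_group R m) : Gr :=
  Grassmannian hdm (dim_frame_span Q).

HB.instance Definition _ :=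
  isPointed.Build Gr (grassmannian_pi (orthogonal1 R m)).

(* Quotient topology of [orthogonal_group R m] along [grassmannian_pi]. *)
Definition grassmannian_open : set_system Gr :=
  [set U | open (grassmannian_pi @^-1` U)].

Fact grassmannian_openT : grassmannian_open setT.
Proof. by rewrite /grassmannian_open /= preimage_setT; exact: openT. Qed.

Fact grassmannian_openI : setI_closed grassmannian_open.
Proof. by move=> U V oU oV; exact: openI. Qed.

Fact grassmannian_open_bigcup (I : Type) (f : I -> set Gr) :
  (forall i, grassmannian_open (f i)) -> grassmannian_open (\bigcup_i f i).
Proof.
move=> fo; rewrite /grassmannian_open /= preimage_bigcup.
by apply: bigcup_open => i _; exact: fo.
Qed.

HB.instance Definition _ := isOpenTopological.Build Gr
  grassmannian_openT grassmannian_openI grassmannian_open_bigcup.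

HB.instance Definition _ := Measurable.copy Gr (g_sigma_algebraType (@open Gr)).

Fact measurable_grassmannian_pi : measurable_fun setT grassmannian_pi.
Proof.
apply: (@measurability _ _ _ _ _ _ (@open Gr)) => // _ [U oU <-].
by rewrite setTI; apply: sub_sigma_algebra; exact: oU.
Qed.

HB.instance Definition _ :=
  isMeasurableFun.Build _ _ _ _ grassmannian_pi measurable_grassmannian_pi.

End grassmannian.

(* The image in the Grassmannian of a measure on the orthogonal group; when
   [mu] is the Haar probability measure, this is the Haar probability measure
   of the Grassmannian. *)
Definition grassmannian_prob (R : realType) (d m : nat) (hdm : (d <= m)%N)
    (mu : probability (orthogonal_group R m) R) :
    probability (grassmannian R hdm) R :=
  distribution mu (@grassmannian_pi R d m hdm).

(* [M|_D] is positive semidefinite. *)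
Definition psd_on (R : realType) (m : nat) (M : 'M[R]_m)
    (D : {vspace 'cV[R]_m}) : Prop :=
  forall v : 'cV[R]_m, v \in D -> 0 <= (v^T *m M *m v) 0 0.

(* Main.v *)
Require Import Defs.
From HB Require Import structures.
From mathcomp Require Import all_boot all_order all_algebra.
From mathcomp Require Import all_classical all_reals all_analysis.
From mathcomp Require Import measurable_realfun complex ring lra.

(* Chernoff's bound for a Gaussian frame.  Put [S = 1 - 2tM], which is positive
   definite, let [G] be an [m x d] matrix with density proportional to
   [exp(- tr(G^T G))], and let [X] be Haar distributed in O(m).
   - For fixed [X], the integral over [G] of [exp(- tr(G^T X S X^T G))] is
     [K * det(S)^(-d/2)].
   - For fixed [G], write [G = Q^T B] with [Q] orthogonal and [B] zero below row
     [d].  Left invariance replaces [X^T G] by [X^T B], whose columns lie in the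
     span of the first [d] columns of [X^T]; when [M] is positive semidefinite
     on that span the integrand is at least [exp(- tr(G^T G))].
   Tonelli's theorem compares the two.  It remains to exchange [X] and [X^-1],
   and the law of [X] is invariant under inversion: for an independent copy [Y],
   compute the probability of the event that [X^-1 Y] is in [A] by conditioning
   on [X], and then on [Y]. *)

Set Implicit Arguments.
Unset Strict Implicit.
Unset Printing Implicit Defensive.

Import Order.TTheory GRing.Theory Num.Theory.
Import numFieldNormedType.Exports.

Local Open Scope classical_set_scope.
Local Open Scope ring_scope.

(** * Quadratic forms and positive definiteness *)

Definition qform (R : pzRingType) (n : nat) (S : 'M[R]_n) (x : 'cV[R]_n) : R :=
  (x^T *m S *m x) 0 0.

Definition posdef (R : numDomainType) (n : nat) (S : 'M[R]_n) : Prop :=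
  forall x : 'cV[R]_n, x != 0 -> 0 < qform S x.

Section quadratic_forms.
Context (R : rcfType).

Lemma qformE n (S : 'M[R]_n) x :
  qform S x = \sum_i \sum_j x i 0 * S i j * x j 0.
Proof.
rewrite /qform mxE exchange_big; apply: eq_bigr => j _ /=.
by rewrite mxE big_distrl /=; apply: eq_bigr => i _; rewrite mxE.
Qed.

Lemma qform1 n (x : 'cV[R]_n) : qform 1%:M x = \sum_i x i 0 ^+ 2.
Proof.
by rewrite /qform mulmx1 mxE; apply: eq_bigr => i _; rewrite mxE expr2.
Qed.

Lemma qform1_gt0 n (x : 'cV[R]_n) : x != 0 -> 0 < qform 1%:M x.
Proof.
move=> x0; rewrite qform1 lt_def sumr_ge0 => [|i _]; last exact: sqr_ge0.
rewrite andbT psumr_eq0 => [|i _]; last exact: sqr_ge0.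
apply: contra x0 => /allP h; apply/eqP/matrixP => i j.
by have /eqP/eqP := h i (mem_index_enum i); rewrite sqrf_eq0 ord1 mxE => /eqP.
Qed.

Lemma qformB n (S T : 'M[R]_n) x : qform (S - T) x = qform S x - qform T x.
Proof. by rewrite /qform mulmxBr mulmxBl [LHS]mxE [X in _ + X]mxE. Qed.

Lemma qformZ n a (S : 'M[R]_n) x : qform (a *: S) x = a * qform S x.
Proof. by rewrite /qform -scalemxAr -scalemxAl mxE. Qed.

Lemma qform_congr m n (S : 'M[R]_n) (Q : 'M[R]_(n, m)) x :
  qform (Q^T *m S *m Q) x = qform S (Q *m x).
Proof. by rewrite /qform trmx_mul !mulmxA. Qed.

Lemma posdef_congr n (S Q : 'M[R]_n) :
  Q \in unitmx -> posdef S -> posdef (Q^T *m S *m Q).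
Proof.
move=> Qu pS x x0; rewrite qform_congr; apply: pS; apply: contra x0 => /eqP.
by move/(congr1 (mulmx (invmx Q))); rewrite mulKmx // mulmx0 => ->.
Qed.

(** * Eigenvalues: the determinant and definiteness of [1 - s M] *)

(** Since [1 - s M = s (s^-1 - M)], the determinant is [s^n] times the characteristic polynomial at
    [s^-1]. *)
Lemma det_1B_char_poly n (M : 'M[R]_n) (lam : 'I_n -> R) s : s != 0 ->
  char_poly M = \prod_(i < n) ('X - (lam i)%:P) ->
  \det (1%:M - s *: M) = \prod_(i < n) (1 - s * lam i).
Proof.
move=> s0 hlam.
have -> : 1%:M - s *: M = s *: (s^-1%:M - M).
  by rewrite scalerBr scale_scalar_mx divff.
have E : (char_poly M).[s^-1] = \det (s^-1%:M - M).
  rewrite /char_poly -horner_evalE -det_map_mx; congr (\det _).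
  apply/matrixP => i j; rewrite !mxE /= /horner_eval hornerD hornerN hornerC.
  by rewrite hornerMn hornerX.
rewrite detZ -E hlam horner_prod -[in X in X * _](card_ord n) -prodr_const.
by rewrite -big_split; apply: eq_bigr => i _; rewrite /= !hornerE mulrBr divff.
Qed.

(** Diagonalize over the complex numbers by a unitary [P]. With [w = P x], the two forms become the
    sums of [D_i |w_i|^2] and of [|w_i|^2], and every [D_i] is one of the [lam j]. *)
Lemma qform_le_eigenvalue n (M : 'M[R]_n) (lam : 'I_n -> R) lmax x :
  M^T = M -> char_poly M = \prod_(i < n) ('X - (lam i)%:P) ->
  (forall i, lam i <= lmax) -> qform M x <= lmax * qform 1%:M x.
Proof.
move=> hM hlam hmax.
pose f := real_complex R; pose A := map_mx f M.
have AT : A^T = A by rewrite /A map_trmx hM.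
have Areal : A \is a mxOver Num.real.
  by apply/mxOverP => i j; rewrite mxE; apply/complex_realP; exists (M i j).
have /orthomx_spectralP : A \is normalmx.
  by apply: symmetric_normalmx => //; apply/is_hermitianmxP; rewrite expr0
    scale1r map_mx_id.
set P := spectralmx A; set D := spectral_diag A => eA.
have PU : P \is unitarymx := spectral_unitarymx A.
have Pu : P \in unitmx := spectral_unit A.
(* Row [i] of [P] is a left eigenvector for [D 0 i], nonzero because [P] is invertible; so [D 0 i]
   is a root of the characteristic polynomial. *)
have rootD i : exists j, D 0 i = f (lam j).
  have : eigenvalue A (D 0 i).
    apply/eigenvalueP; exists (row i P).
      rewrite -row_mul {1}eA !mulmxA mulmxV // mul1mx.
      by rewrite row_mul row_diag_mx -scalemxAl -rowE.
    apply/negP => /eqP r0; have := congr1 (row i) (mulmxV Pu).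
    rewrite row_mul r0 mul0mx row1 => /matrixP/(_ 0 i).
    by rewrite !mxE !eqxx => /eqP; rewrite eq_sym oner_eq0.
  rewrite eigenvalue_root_char -map_char_poly hlam rmorph_prod /=.
  under eq_bigr do rewrite rmorphB /= map_polyX map_polyC.
  rewrite rootE horner_prod => /prodf_eq0 [j _].
  by rewrite hornerXsubC subr_eq0 => /eqP ->; exists j.
pose w := P *m map_mx f x.
(* As [x] is real, its transpose is its conjugate transpose, which turns the forms into Hermitian
   ones. *)
have fx1 : (map_mx f x)^T = (map_mx f x ^t* )%sesqui.
  apply/matrixP => i j; rewrite !mxE; apply/esym/CrealP/complex_realP.
  by exists (x j 0); rewrite ord1.
have qM : f (qform M x) = \sum_i D 0 i * (w i 0 * (w i 0)^* ).
  have -> : f (qform M x) = ((map_mx f x)^T *m A *m map_mx f x) 0 0.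
    by rewrite map_trmx -!map_mxM mxE.
  rewrite eA invmx_unitary // fx1 !mulmxA -map_mxM -trmx_mul -mulmxA mxE.
  apply: eq_bigr => i _; rewrite mul_mx_diag !mxE -/w.
  by rewrite mulrAC mulrC; congr (_ * _); exact: mulrC.
have q1 : f (qform 1%:M x) = \sum_i w i 0 * (w i 0)^*.
  have -> : f (qform 1%:M x) = ((map_mx f x)^T *m map_mx f x) 0 0.
    by rewrite map_trmx -!map_mxM mxE /qform mulmx1.
  rewrite -[X in _ *m X]mul1mx -(mulVmx Pu) invmx_unitary // fx1.
  rewrite !mulmxA -map_mxM -trmx_mul -mulmxA mxE.
  by apply: eq_bigr => i _; rewrite !mxE; exact: mulrC.
rewrite -lecR rmorphM /= -/f qM q1 mulr_sumr; apply: ler_sum => i _.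
rewrite ler_wpM2r ?mul_conjC_ge0 //.
by have [j ->] := rootD i; rewrite lecR.
Qed.

Lemma posdef_1B n (M : 'M[R]_n) (lam : 'I_n -> R) lmax s :
  M^T = M -> char_poly M = \prod_(i < n) ('X - (lam i)%:P) ->
  (forall i, lam i <= lmax) -> 0 <= s -> s * lmax < 1 ->
  posdef (1%:M - s *: M).
Proof.
move=> hM hlam hmax s0 s1 x x0; rewrite qformB qformZ subr_gt0.
have q0 := qform1_gt0 x0.
apply: (@le_lt_trans _ _ (s * (lmax * qform 1%:M x))).
  by rewrite ler_wpM2l // (qform_le_eigenvalue x hM hlam).
by rewrite mulrA -[ltRHS]mul1r ltr_pM2r.
Qed.

(** * Triangularization by Householder reflections *)

(* [2 / 0 = 0], so the reflection along [u = 0] is the identity. *)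
Definition reflection n (u : 'cV[R]_n) : 'M[R]_n :=
  1%:M - (2 / qform 1%:M u) *: (u *m u^T).

Lemma reflection_orthogonal n (u : 'cV[R]_n) :
  (reflection u)^T *m reflection u = 1%:M.
Proof.
have -> : (reflection u)^T = reflection u.
  by rewrite /reflection raddfB /= linearZ /= trmx_mul trmxK trmx1.
have uu : u *m u^T *m (u *m u^T) = qform 1%:M u *: (u *m u^T).
  rewrite mulmxA -[u *m u^T *m u]mulmxA [u^T *m u]mx11_scalar.
  by rewrite mul_mx_scalar -scalemxAl /qform mulmx1.
have qq : 2 / qform 1%:M u * (2 / qform 1%:M u) * qform 1%:M u
    = 2 / qform 1%:M u + 2 / qform 1%:M u.
  have [->|q0] := eqVneq (qform 1%:M u) 0; first by rewrite invr0 !mulr0 addr0.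
  by field.
rewrite /reflection mulmxBl mul1mx mulmxBr mulmx1 -scalemxAl -scalemxAr uu.
by rewrite !scalerA qq scalerDl opprB addrK subrK.
Qed.

Lemma reflection_mul n p (u : 'cV[R]_n) (A : 'M[R]_(n, p)) i j :
  (reflection u *m A) i j
  = A i j - 2 / qform 1%:M u * (u^T *m A) 0 j * u i 0.
Proof.
rewrite /reflection mulmxBl mul1mx -scalemxAl -mulmxA.
rewrite [LHS]mxE; congr (_ + _); rewrite [LHS]mxE; congr (- _).
by rewrite [LHS]mxE -mulrA; congr (_ * _); rewrite mxE big_ord1 mulrC.
Qed.

(* Take [u = w - |w| e_k], where [w] is [v] with its first [k] entries erased;
   being zero before [k], [u] does not disturb the columns already reduced. *)
Lemma reflection_tail n (v : 'cV[R]_n) (k : 'I_n) :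
  exists u : 'cV[R]_n, (forall i : 'I_n, (i < k)%N -> u i 0 = 0) /\
    forall i : 'I_n, (k < i)%N -> (reflection u *m v) i 0 = 0.
Proof.
pose w : 'cV[R]_n := \col_i (if (i < k)%N then 0 else v i 0).
pose s := Num.sqrt (qform 1%:M w).
pose u : 'cV[R]_n := w - s *: delta_mx k 0.
have q0 : 0 <= qform 1%:M w by rewrite qform1 sumr_ge0 // => i _; exact: sqr_ge0.
have ss : s * s = qform 1%:M w by rewrite -expr2 sqr_sqrtr.
exists u; split.
  by move=> i ik; rewrite !mxE ik -val_eqE /= (ltn_eqF ik) mulr0 subrr.
have wk : w k 0 = v k 0 by rewrite mxE ltnn.
have wwE x : x = v \/ x = w -> (w^T *m x) 0 0 = s * s.
  move=> xE; rewrite ss qform1 mxE; apply: eq_bigr => j _; rewrite 2!mxE.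
  by case: xE => ->; rewrite ?mxE; case: ifP => _; rewrite ?mul0r ?expr0n ?expr2.
have uxE x : x = v \/ x = w -> (u^T *m x) 0 0 = s * s - s * x k 0.
  move=> xE; rewrite /u raddfB /= linearZ /= trmx_delta mulmxBl -scalemxAl -rowE.
  by rewrite mxE (wwE _ xE) 2!mxE; congr (_ - (_ * _)); rewrite mxE.
(* Thus [u^T u = 2 u^T v]: unless both vanish, the reflection sends [v] to [v - u], and [u] agrees
   with [v] after entry [k]. *)
have uu : qform 1%:M u = 2 * (s * s - s * v k 0).
  rewrite /qform mulmx1 {2}/u mulmxBr -scalemxAr -colE.
  rewrite mxE uxE; last by right.
  by rewrite !mxE eqxx mulr1 ltnn; ring.
have uv := uxE v (or_introl erefl).
move=> i ki; rewrite reflection_mul uu uv.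
(* In the degenerate case [u = 0], that is [w = s e_k], so [v] already vanishes after entry [k]. *)
have [c0|c0] := eqVneq (s * s - s * v k 0) 0.
  have u0 : u = 0.
    apply/eqP; apply/negPn/negP => /qform1_gt0.
    by rewrite uu c0 mulr0 ltxx.
  have /matrixP/(_ i 0) := u0; rewrite !mxE -val_eqE /= (gtn_eqF ki) mulr0 subr0.
  rewrite ltnNge (ltnW ki) /= => ->.
  by rewrite c0 mulr0 subr0.
rewrite !mxE -val_eqE /= (gtn_eqF ki) ltnNge (ltnW ki) /= mulr0 subr0.
by rewrite -mulrA; field.
Qed.

(** Householder reduction, one column at a time. The invariant is that the first [k] columns vanish
    from row [k] on. The next [u] is zero before row [k], hence orthogonal to these columns, and its
    reflection fixes them. *)
Lemma orthogonal_triangularize m d (hdm : (d <= m)%N) (G : 'M[R]_(m, d)) :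
  exists2 Q : 'M[R]_m, Q^T *m Q = 1%:M &
    forall (i : 'I_m) (j : 'I_d), (d <= i)%N -> (Q *m G) i j = 0.
Proof.
suff H k : (k <= d)%N -> exists2 Q : 'M[R]_m, Q^T *m Q = 1%:M &
    forall (i : 'I_m) (j : 'I_d), (j < k)%N -> (k <= i)%N -> (Q *m G) i j = 0.
  by have [Q oQ hQ] := H d (leqnn d); exists Q => // i j; exact: hQ.
elim: k => [_|k IH kd]; first by exists 1%:M => //; rewrite trmx1 mulmx1.
have [Q oQ hQ] := IH (ltnW kd).
have [u [u0 hu]] :=
  reflection_tail (col (Ordinal kd) (Q *m G)) (Ordinal (leq_trans kd hdm)).
exists (reflection u *m Q) => [|i j].
  by rewrite trmx_mul mulmxA -(mulmxA _ _ (reflection u))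
    reflection_orthogonal mulmx1.
rewrite -mulmxA ltnS leq_eqVlt => /predU1P[jk ki|jk ki].
  have -> : j = Ordinal kd by exact/val_inj.
  by rewrite -(hu i ki) colE [in RHS]mulmxA -colE [RHS]mxE.
rewrite reflection_mul (hQ i j jk (ltnW ki)) mxE big1 => [|l _].
  by rewrite mulr0 mul0r subrr.
rewrite mxE; have [lk|kl] := ltnP l k; first by rewrite u0 // mul0r.
by rewrite hQ // mulr0.
Qed.

(** * Schur complement of the top left entry *)

Definition schur n (S : 'M[R]_(1 + n)) : 'M[R]_n :=
  drsubmx S - (S 0 0)^-1 *: (dlsubmx S *m ursubmx S).

Lemma posdef_diag n (S : 'M[R]_n) i : posdef S -> 0 < S i i.
Proof.
move=> /(_ (delta_mx i 0)); rewrite /qform trmx_delta -rowE -colE !mxE; apply.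
apply/eqP => /matrixP/(_ i 0); rewrite !mxE !eqxx => /eqP.
by rewrite oner_eq0.
Qed.

(** One step of Gaussian elimination: the unit lower triangular [L] clears the first column below
    the pivot. *)
Lemma det_schur n (S : 'M[R]_(1 + n)) : S 0 0 != 0 ->
  \det S = S 0 0 * \det (schur S).
Proof.
move=> c0; pose L : 'M[R]_(1 + n) :=
  block_mx 1%:M 0 (- (S 0 0)^-1 *: dlsubmx S) 1%:M.
have ulS : ulsubmx S = (S 0 0)%:M.
  apply/matrixP => i j; rewrite !ord1 !mxE eqxx; congr (S _ _);
  exact/val_inj.
have <- : \det (L *m S) = \det S by rewrite det_mulmx det_lblock !det1 !mul1r.
rewrite -{1}[S]submxK mulmx_block !mul1mx !mul0mx !addr0 ulS.
rewrite mul_mx_scalar scalerA mulrN divff // scaleN1r addNr det_ublock det_scalar1.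
by rewrite -scalemxAl scaleNr addrC.
Qed.

(** Completing the square in the first coordinate [z]. *)
Lemma qform_schur n (S : 'M[R]_(1 + n)) (z : R) (y : 'cV[R]_n) :
  S^T = S -> S 0 0 != 0 ->
  qform S (col_mx z%:M y)
  = S 0 0 * (z + (S 0 0)^-1 * (ursubmx S *m y) 0 0) ^+ 2 + qform (schur S) y.
Proof.
move=> ST c0.
have ulS : ulsubmx S = (S 0 0)%:M.
  apply/matrixP => i j; rewrite !ord1 !mxE eqxx; congr (S _ _);
  exact/val_inj.
have dlS : dlsubmx S = (ursubmx S)^T by rewrite trmx_ursub ST.
rewrite /qform /schur -{1}[S]submxK tr_col_mx.
rewrite tr_scalar_mx mul_row_block mul_row_col ulS dlS.
set b := ursubmx S; set D := drsubmx S; set c := S 0 0 in c0 *.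
set beta := (b *m y) 0 0.
have byE : b *m y = beta%:M by rewrite [b *m y]mx11_scalar.
have ybE : y^T *m b^T = beta%:M by rewrite -trmx_mul byE tr_scalar_mx.
rewrite !mulmxDl mulmxBr mulmxBl -scalemxAr -scalemxAl ybE.
rewrite -[z%:M *m b *m y]mulmxA byE [y^T *m (b^T *m b)]mulmxA ybE.
rewrite -[beta%:M *m b *m y]mulmxA byE -!scalar_mxM scale_scalar_mx.
rewrite !mxE eqxx !mulr1n.
by field.
Qed.

Lemma schur_sym n (S : 'M[R]_(1 + n)) : S^T = S -> (schur S)^T = schur S.
Proof.
move=> ST; rewrite /schur raddfB /= linearZ /= trmx_mul.
by rewrite trmx_dlsub trmx_ursub trmx_drsub ST.
Qed.

(** Choosing [z] so that the completed square vanishes exhibits each value of the complement as a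
    value of [S]. *)
Lemma posdef_schur n (S : 'M[R]_(1 + n)) :
  S^T = S -> posdef S -> posdef (schur S).
Proof.
move=> ST pS y y0; have c0 : S 0 0 != 0 by rewrite gt_eqF // posdef_diag.
have := pS (col_mx (- ((S 0 0)^-1 * (ursubmx S *m y) 0 0))%:M y).
rewrite qform_schur // addNr expr0n mulr0 add0r; apply.
by rewrite col_mx_eq0 negb_and y0 orbT.
Qed.

End quadratic_forms.

(** * Products of sigma-finite measures *)

Section product_sigma_finite.
Context d1 d2 (T1 : measurableType d1) (T2 : measurableType d2) (R : realType)
  (m1 : {sigma_finite_measure set T1 -> \bar R})
  (m2 : {sigma_finite_measure set T2 -> \bar R}).

(* The library's sigma-finite instance on [m1 \x m2] is shadowed by the one for
   subprobabilities. *)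
Definition product_sigma_finite : set (T1 * T2) -> \bar R := (m1 \x m2)%E.
HB.instance Definition _ := Measure.on product_sigma_finite.

Lemma product_sigma_finiteP : sigma_finite setT product_sigma_finite.
Proof.
have [F TF Foo] := sigma_finiteT m1; have [G TG Goo] := sigma_finiteT m2.
(* Rectangles are enumerated through codes of pairs; a number coding no pair repeats the rectangle
   [(0, 0)]. *)
pose p n : nat * nat := odflt (0%N, 0%N) (unpickle n).
exists (fun n => F (p n).1 `*` G (p n).2) => [|n].
  apply/seteqP; split=> // -[x y] _.
  have [i _ Fx] : (\bigcup_i F i) x by rewrite -TF.
  have [j _ Gy] : (\bigcup_j G j) y by rewrite -TG.
  by exists (pickle (i, j)) => //; rewrite /p pickleK.
have [mF F_fin] := Foo (p n).1; have [mG G_fin] := Goo (p n).2.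
split; first exact: measurableX.
rewrite /product_sigma_finite product_measure1E // lte_mul_pinfty //.
by rewrite ge0_fin_numE.
Qed.

HB.instance Definition _ := Measure_isSigmaFinite.Build _ _ _
  product_sigma_finite product_sigma_finiteP.
End product_sigma_finite.

(** * Entrywise measurability of random matrices *)

Section measurable_mx.
Context (R : realType) (disp : measure_display) (T : measurableType disp).

Definition measurable_mx m n (A : T -> 'M[R]_(m, n)) : Prop :=
  forall i j, measurable_fun setT (fun w => A w i j).

Lemma measurable_mx_cst m n (A : 'M[R]_(m, n)) : measurable_mx (fun=> A).
Proof. by move=> i j; exact: measurable_cst. Qed.

Lemma measurable_mx_tr m n (A : T -> 'M[R]_(m, n)) :
  measurable_mx A -> measurable_mx (fun w => (A w)^T).
Proof. by move=> mA i j; under eq_fun do rewrite mxE; exact: mA. Qed.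

Lemma measurable_mx_mul m n p (A : T -> 'M[R]_(m, n)) (B : T -> 'M[R]_(n, p)) :
  measurable_mx A -> measurable_mx B -> measurable_mx (fun w => A w *m B w).
Proof.
move=> mA mB i j; under eq_fun do rewrite mxE.
by apply: measurable_sum => k; exact: measurable_funM.
Qed.

Lemma measurable_mx_trace n (A : T -> 'M[R]_n) :
  measurable_mx A -> measurable_fun setT (fun w => \tr (A w)).
Proof. by move=> mA; apply: measurable_sum => i; exact: mA. Qed.

Lemma measurable_mx_scalar n (f : T -> R) :
  measurable_fun setT f -> measurable_mx (fun w => (f w)%:M : 'M[R]_n).
Proof.
move=> mf i j; under eq_fun do rewrite mxE.
by case: (i == j); [exact: mf|exact: measurable_cst].
Qed.

Lemma measurable_mx_col m1 m2 n (A : T -> 'M[R]_(m1, n)) (B : T -> 'M[R]_(m2, n)) :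
  measurable_mx A -> measurable_mx B ->
  measurable_mx (fun w => col_mx (A w) (B w)).
Proof.
move=> mA mB i j; under eq_fun do rewrite mxE.
by case: (fintype.split i) => k; [exact: mA|exact: mB].
Qed.

Lemma measurable_mx_row m n1 n2 (A : T -> 'M[R]_(m, n1)) (B : T -> 'M[R]_(m, n2)) :
  measurable_mx A -> measurable_mx B ->
  measurable_mx (fun w => row_mx (A w) (B w)).
Proof.
move=> mA mB i j; under eq_fun do rewrite mxE.
by case: (fintype.split j) => k; [exact: mA|exact: mB].
Qed.

Lemma measurable_mx_qform n (S : 'M[R]_n) (x : T -> 'cV[R]_n) :
  measurable_mx x -> measurable_fun setT (fun w => qform S (x w)).
Proof.
move=> mx; have mS := measurable_mx_cst S.
exact: (measurable_mx_mul (measurable_mx_mul (measurable_mx_tr mx) mS) mx 0 0).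
Qed.

End measurable_mx.

(** * Gaussian integrals over vectors and matrices *)

Section gaussian.
Context (R : realType).

Lemma integral_gauss (c b : R) : 0 < c ->
  (\int[lebesgue_measure]_z (expR (- (c * (z + b) ^+ 2)))%:E
   = (Num.sqrt pi / Num.sqrt c)%:E)%E.
Proof.
(* With [c = 1 / (2 s^2)], the integrand is a multiple of the normal density of mean [- b] and
   standard deviation [s]. *)
move=> c0; pose s : R := (Num.sqrt (2 * c))^-1.
have s0 : s != 0 by rewrite invr_eq0 gt_eqF // sqrtr_gt0 mulr_gt0.
have s2 : s ^+ 2 = (2 * c)^-1 by rewrite exprVn sqr_sqrtr // mulr_ge0 // ltW.
have pE x : expR (- (c * (x + b) ^+ 2)) = (normal_peak s)^-1 * normal_pdf (- b) s x.
  rewrite normal_pdfE // mulKf ?gt_eqF ?normal_peak_gt0 // /normal_fun s2 opprK.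
  congr expR; field; by rewrite gt_eqF.
under eq_integral do rewrite pE EFinM.
rewrite integralZl //=; last exact: integrable_normal_pdf.
rewrite integral_normal_pdf mule1 /normal_peak invrK s2; congr (_%:E).
rewrite -[RHS]mulr1 -sqrtrV ?ltW // mulr1 -sqrtrM ?pi_ge0 //; congr Num.sqrt.
by rewrite -mulr_natr; field; rewrite gt_eqF.
Qed.

(* [x] plays the role of the identity of R^n with Lebesgue measure; the space is
   left abstract since it is built by iterating binary products. *)
Lemma gaussian_vector n :
  exists (disp : measure_display) (T : measurableType disp)
    (P : {sigma_finite_measure set T -> \bar R}) (x : T -> 'cV[R]_n) (K : R),
  [/\ 0 < K, measurable_mx x &
    forall S, S^T = S -> posdef S ->
      (\int[P]_w (expR (- qform S (x w)))%:E
       = (K / Num.sqrt (\det S))%:E)%E].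
Proof.
elim: n => [|n [disp [T [P [x [K [K0 mx IH]]]]]]].
  (* R^0 is a single point of mass 1, and the empty determinant is 1. *)
  exists _, unit, (@dirac _ unit tt R), (fun=> 0), 1; split => //.
  move=> S _ _; rewrite integral_dirac //= diracT mul1e /qform mulmx0 mxE oppr0 expR0.
  by rewrite det_mx00 sqrtr1 divr1.
pose leb : {sigma_finite_measure set (measurableTypeR R) -> \bar R} :=
  @lebesgue_measure R.
exists _, (T * measurableTypeR R)%type, (product_sigma_finite P leb),
  (fun wz => col_mx (wz.2)%:M (x wz.1)), (Num.sqrt pi * K).
have mcol : measurable_mx
    (fun wz : T * measurableTypeR R => col_mx (wz.2)%:M (x wz.1)).
  apply: measurable_mx_col; first exact: measurable_mx_scalar measurable_snd.
  by move=> i j; exact: (measurableT_comp (mx i j) measurable_fst).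
split => //; first by rewrite mulr_gt0 // sqrtr_gt0 pi_gt0.
move=> S ST pS; have c0 := posdef_diag 0 pS.
rewrite fubini_tonelli1 /=; last first.
- by move=> wz; rewrite lee_fin expR_ge0.
- apply/measurable_EFinP/measurableT_comp => //; apply: measurableT_comp => //.
  exact: measurable_mx_qform.
rewrite /fubini_F /=.
have mq : measurable_fun setT (fun w => (expR (- qform (schur S) (x w)))%:E).
  apply/measurable_EFinP/measurableT_comp => //; apply: measurableT_comp => //.
  exact: measurable_mx_qform.
(* For fixed [w], completing the square leaves a shifted one-dimensional Gaussian in the new
   coordinate; the remaining factor is the Gaussian of the Schur complement. *)
transitivity (\int[P]_w ((Num.sqrt pi / Num.sqrt (S 0 0))%:E
    * (expR (- qform (schur S) (x w)))%:E))%E.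
  apply: eq_integral => w _.
  rewrite -(integral_gauss ((S 0 0)^-1 * (@ursubmx _ 1 n 1 n S *m x w) 0 0) c0).
  rewrite -ge0_integralZr //=; last first.
  - apply/measurable_EFinP/measurableT_comp => //; apply: measurableT_comp => //.
    apply: measurable_funM => //; apply: measurable_funX.
    exact: measurable_funD.
  apply: eq_integral => z _.
  by rewrite (@qform_schur _ n) // ?gt_eqF // opprD expRD EFinM.
rewrite ge0_integralZl //=.
rewrite IH; [|exact: schur_sym|exact: posdef_schur].
rewrite -EFinM (@det_schur _ n) ?gt_eqF // sqrtrM ?ltW //; congr (_%:E).
by rewrite invfM; ring.
Qed.

Lemma mxtrace_gram_row (m n : nat) (S : 'M[R]_m) (x : 'cV[R]_m) (G : 'M[R]_(m, n)) :
  \tr ((row_mx x G)^T *m S *m row_mx x G) = qform S x + \tr (G^T *m S *m G).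
Proof.
rewrite tr_row_mx mul_col_mx mul_col_row mxtrace_block; congr (_ + _).
by rewrite [X in \tr X]mx11_scalar mxtrace_scalar.
Qed.

(** The trace is the sum of the forms at the columns, so the integral over [d] independent columns
    is a product of [d] equal factors. The constant [K] is the same for all [S], so it cancels when
    two choices of [S] are compared. *)
Lemma gaussian_matrix m d :
  exists (disp : measure_display) (T : measurableType disp)
    (P : {sigma_finite_measure set T -> \bar R}) (G : T -> 'M[R]_(m, d)) (K : R),
  [/\ 0 < K, measurable_mx G &
    forall S, S^T = S -> posdef S ->
      (\int[P]_w (expR (- \tr ((G w)^T *m S *m G w)))%:E
       = (K / Num.sqrt (\det S) ^+ d)%:E)%E].
Proof.
elim: d => [|d [disp [T [P [G [K [K0 mG IH]]]]]]].
  exists _, unit, (@dirac _ unit tt R), (fun=> 0), 1; split => //.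
  move=> S _ _; rewrite integral_dirac //= diracT mul1e.
  by rewrite mulmx0 mxtrace0 oppr0 expR0 expr0 divr1.
have [disp1 [T1 [P1 [x [K1 [K10 mx IHx]]]]]] := gaussian_vector m.
exists _, (T1 * T)%type, (product_sigma_finite P1 P),
  (fun w => row_mx (x w.1) (G w.2)), (K1 * K).
have mrow : measurable_mx (fun w : T1 * T => row_mx (x w.1) (G w.2)).
  apply: measurable_mx_row => i j.
  - exact: (measurableT_comp (mx i j) measurable_fst).
  - exact: (measurableT_comp (mG i j) measurable_snd).
split; [exact: mulr_gt0|exact: mrow|].
move=> S ST pS.
have mx1 : measurable_fun setT (fun w => (expR (- qform S (x w)))%:E).
  apply/measurable_EFinP/measurableT_comp => //; apply: measurableT_comp => //.
  exact: measurable_mx_qform.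
have mG1 : measurable_fun setT
    (fun w => (expR (- \tr ((G w)^T *m S *m G w)))%:E).
  apply/measurable_EFinP/measurableT_comp => //; apply: measurableT_comp => //.
  apply/measurable_mx_trace/measurable_mx_mul => //.
  by apply: measurable_mx_mul; [exact: measurable_mx_tr|exact: measurable_mx_cst].
under eq_integral do rewrite mxtrace_gram_row opprD expRD EFinM.
rewrite fubini_tonelli1 /=; last first.
- by move=> w; rewrite mule_ge0 // lee_fin expR_ge0.
- apply: emeasurable_funM.
  + exact: (measurableT_comp mx1 measurable_fst).
  + exact: (measurableT_comp mG1 measurable_snd).
rewrite /fubini_F /=.
under eq_integral => w _.
  rewrite ge0_integralZl //=.
  rewrite IH //; over.
rewrite ge0_integralZr //=; last first.
  by rewrite lee_fin divr_ge0 ?exprn_ge0 ?sqrtr_ge0 ?ltW.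
by rewrite IHx // -EFinM; congr (_%:E); rewrite exprS invfM; ring.
Qed.

End gaussian.

(** * Measurability of positive semidefiniteness *)

Section psd.
Context (R : realType).

(* Round [a * w] for large [a].  Testing on integer vectors makes positive
   semidefiniteness a countable intersection of measurable events, also on
   product spaces, whose sigma-algebra is not known to be Borel. *)
Lemma qform_int_ge0 n (N : 'M[R]_n) :
  (forall w : 'cV[int]_n, 0 <= qform N (map_mx intr w)) ->
  forall w : 'cV[R]_n, 0 <= qform N w.
Proof.
move=> hN w; rewrite leNgt; apply/negP => q0.
pose C := \sum_i \sum_j `|N i j| * (`|w i 0| + `|w j 0|).
pose C' := \sum_i \sum_j `|N i j|.
have C0 : 0 <= C.
  by do 2 (apply: sumr_ge0 => ? _); rewrite mulr_ge0 // addr_ge0.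
have C'0 : 0 <= C' by do 2 (apply: sumr_ge0 => ? _).
(* This choice gives [a q = q - (C + C')] for [q = qform N w < 0]. As [a >= 1], the bound
   [a^2 q + a C + C'] is at most [a (a q + C + C') = a q < 0]. *)
pose a := (C + C') / (- qform N w) + 1.
have a1 : 1 <= a by rewrite lerDr divr_ge0 // ?addr_ge0 // oppr_ge0 ltW.
have a0 : 0 <= a by exact: le_trans a1.
pose z : 'cV[int]_n := \col_i Num.floor (a * w i 0).
have qz : qform N (map_mx intr z) <= a ^+ 2 * qform N w + a * C + C'.
  rewrite !qformE !mulr_sumr -!big_split /=; apply: ler_sum => i _.
  rewrite !mulr_sumr -!big_split /=; apply: ler_sum => j _.
  rewrite !mxE; set x := w i 0; set y := w j 0; set c := N i j.
  have fl (u : R) : exists2 e, (Num.floor (a * u))%:~R = a * u - e & `|e| <= 1.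
    exists (a * u - (Num.floor (a * u))%:~R); first by rewrite opprB addrC subrK.
    have /andP[h1 h2] := real_floor_itv (num_real (a * u)).
    by move: h2; rewrite ger0_norm ?subr_ge0 // lerBlDl intrD => /ltW.
  have [e -> e1] := fl x; have [f -> f1] := fl y.
  have -> : (a * x - e) * c * (a * y - f)
      = a ^+ 2 * (x * c * y) + a * (- (c * (x * f + e * y))) + c * (e * f) by ring.
  rewrite lerD //.
    rewrite lerD2l ler_wpM2l // (le_trans (ler_norm _)) // normrN normrM.
    rewrite ler_wpM2l // (le_trans (ler_normD _ _)) // !normrM.
    by rewrite lerD // ?ler_piMr // ler_piMl.
  rewrite (le_trans (ler_norm _)) // !normrM -[leRHS]mulr1 ler_wpM2l //.
  by rewrite mulr_ile1.
have := le_trans (hN z) qz; apply/negP; rewrite -ltNge.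
have : a * qform N w = - (C + C') + qform N w.
  by rewrite /a mulrDl mul1r; field; rewrite lt_eqF.
move=> aq; have : a * (a * qform N w + C + C') < 0 by rewrite aq; nra.
by apply: le_lt_trans; nra.
Qed.

Lemma measurable_psd (disp : measure_display) (T : measurableType disp) n
    (N : T -> 'M[R]_n) : measurable_mx N ->
  measurable [set t | forall w : 'cV[R]_n, 0 <= qform (N t) w].
Proof.
move=> mN.
(* Integer vectors are enumerated by their codes; other numbers impose no condition. *)
pose F k : set T := if unpickle k is Some w
  then [set t | 0 <= qform (N t) (map_mx intr (w : 'cV[int]_n))] else setT.
rewrite [X in measurable X](_ : _ = \bigcap_k F k).
  apply: bigcapT_measurable => k; rewrite /F; case: unpickle => [w|] //.
  have mq : measurable_fun setT (fun t => qform (N t) (map_mx intr w)).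
    have mw := @measurable_mx_cst R _ T _ _ (map_mx intr w).
    exact: (measurable_mx_mul (measurable_mx_mul (measurable_mx_tr mw) mN) mw 0 0).
  rewrite [X in measurable X](_ : _ =
    setT `&` (fun t => qform (N t) (map_mx intr w)) @^-1` `[0, +oo[%classic); last first.
    by rewrite setTI; apply/seteqP; split => t /=; rewrite in_itv /= andbT.
  by apply: mq => //; exact: measurable_itv.
apply/seteqP; split => t /= h.
  by move=> k _; rewrite /F; case: unpickle => // w /=.
apply: qform_int_ge0 => w.
by have := h (pickle w) I; rewrite /F pickleK.
Qed.

End psd.

(** * Invariance of Haar measure on the orthogonal group *)

Section orthogonal_group_measurability.
Context (R : realType) (m : nat).
Local Notation O := (orthogonal_group R m).

Lemma orthogonal_entry_continuous i j :
  continuous (fun Q : O => (orthogonal_mx Q) i j).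
Proof.
move=> Q; apply: (continuous_comp (f := @orthogonal_mx R m)
  (g := fun A : ('M[R]_m) => A i j)).
  exact: initial_continuous.
exact: coord_continuous.
Qed.

Lemma measurable_orthogonal_mx : measurable_mx (fun Q : O => orthogonal_mx Q).
Proof.
move=> i j; apply: (measurability _ (RGenOInfty.measurableE R)).
move=> _ [_ [r ->] <-]; rewrite setTI; apply: sub_sigma_algebra.
have /continuousP := @orthogonal_entry_continuous i j; apply.
exact: interval_open.
Qed.

Lemma orthogonalM_continuous (Q : O) : continuous (fun X : O => (Q * X)%g).
Proof.
apply: continuous_comp_initial => X A [P nP PA].
apply: (filterS PA); first by apply: fmap_filter; exact: nbhs_filter.
(* Matrix neighbourhoods are entrywise, so finitely many scalar limits suffice. *)
suff : \forall Y \near X, forall i j, P i j ((Q *m orthogonal_mx Y) i j).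
  exact: id.
apply: (@filter_forall O 'I_m
  (fun i (Y : O) => forall j, P i j ((Q *m orthogonal_mx Y) i j))
  _ (nbhs_filter X)) => i.
apply: (@filter_forall O 'I_m
  (fun j (Y : O) => P i j ((Q *m orthogonal_mx Y) i j)) _ (nbhs_filter X)) => j.
suff : (Q *m orthogonal_mx Y) i j @[Y --> X] --> (Q *m orthogonal_mx X) i j.
  by apply; exact: nP.
under eq_cvg do rewrite mxE.
rewrite mxE; apply: cvg_big => [||k _].
- exact: add_continuous.
- exact: (nbhs_filter X).
apply: cvgMr; first exact: (nbhs_filter X).
exact: orthogonal_entry_continuous.
Qed.

Lemma measurable_orthogonalM (Q : O) : measurable_fun setT (fun X : O => (Q * X)%g).
Proof.
apply: (measurability (@open O)) => // _ [U oU <-].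
rewrite setTI; apply: sub_sigma_algebra.
by have /continuousP := @orthogonalM_continuous Q; apply.
Qed.

Context (mu : probability (orthogonal_group R m) R) (hmu : is_haar mu).

(** Invariance is given for images; this preimage is the image under [Q^-1]. *)
Lemma haar_preimage (Q : O) (A : set O) : measurable A ->
  mu [set X | A (Q * X)%g] = mu A.
Proof.
move=> mA; rewrite -(hmu Q^-1%g mA); congr (mu _).
apply/seteqP; split => [X /= AX|_ [X AX <-] /=].
  by exists (Q * X)%g => //; rewrite mulKg.
by rewrite mulVKg.
Qed.

Lemma haar_integral (Q : O) (f : O -> \bar R) :
  measurable_fun setT f -> (forall X, 0 <= f X)%E ->
  (\int[mu]_X f (Q * X)%g = \int[mu]_X f X)%E.
Proof.
move=> mf f0.
have := @ge0_integral_pushforward _ _ O O R _ (measurable_orthogonalM Q) mu setT f.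
rewrite preimage_setT => <- //.
apply: eq_measure_integral => [|mQ A mA _]; first exact: measurable_orthogonalM.
exact: haar_preimage.
Qed.

(** The section of the joint event at [X] is a left translate of [A]; the section at [Y] is a left
    translate of the inverse of [A]. Tonelli's theorem equates the two averages. Measurability of
    the joint event is assumed, to be checked for the particular [A]. *)
Lemma haar_inv (A : set O) : measurable A -> measurable [set X : O | A (X^-1)%g] ->
  measurable [set XY : O * O | A (XY.1^-1 * XY.2)%g] ->
  mu [set X | A (X^-1)%g] = mu A.
Proof.
move=> mA mA' mB.
have := indic_fubini_tonelli mu mu mB.
rewrite (indic_fubini_tonelli_FE mu mB) (indic_fubini_tonelli_GE mu mB).
have xE (X : O) : mu (xsection [set XY : O * O | A (XY.1^-1 * XY.2)%g] X) = mu A.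
  rewrite -(haar_preimage X^-1%g mA); congr (mu _).
  by apply/seteqP; split => Y; rewrite /xsection /= inE.
have yE (Y : O) : mu (ysection [set XY : O * O | A (XY.1^-1 * XY.2)%g] Y)
    = mu [set X | A (X^-1)%g].
  rewrite -(haar_preimage Y^-1%g mA'); congr (mu _).
  by apply/seteqP; split => X; rewrite /ysection /= inE /= invgM invgK.
under eq_integral do rewrite /= xE.
under [X in _ = X]eq_integral do rewrite /= yE.
have cE (c : \bar R) : (\int[mu]_x c = c)%E.
  by rewrite integral_cst // [X in (_ * X)%E](probability_setT mu) mule1.
by rewrite !cE.
Qed.

End orthogonal_group_measurability.

(** * Semidefiniteness on the span of a random frame *)

Section random_subspace.
Context (R : realType) (m d : nat) (hdm : (d <= m)%N).
Local Notation O := (orthogonal_group R m).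

Lemma frame_spanP (X : O) (v : 'cV[R]_m) :
  v \in frame_span hdm X <->
  exists w : 'cV[R]_d, v = colsub (widen_ord hdm) X *m w.
Proof.
have mulE (w : 'cV[R]_d) : colsub (widen_ord hdm) X *m w
    = \sum_(j < d) w j 0 *: col (widen_ord hdm j) X.
  apply/matrixP => i k; rewrite mxE summxE; apply: eq_bigr => j _.
  by rewrite !mxE !ord1 mulrC.
split=> [/coord_span ->|[w ->]].
  eexists (\col_j _); rewrite mulE; apply: eq_bigr => j _.
  by rewrite mxE (nth_map j) ?size_enum_ord // nth_ord_enum.
rewrite mulE; apply: memv_suml => j _; apply/memvZ/memv_span.
by apply/mapP; exists j => //; rewrite mem_enum.
Qed.

Lemma psd_on_frame_span (M : 'M[R]_m) (X : O) :
  psd_on M (frame_span hdm X) <->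
  forall w, 0 <= qform ((colsub (widen_ord hdm) X)^T *m M
                        *m colsub (widen_ord hdm) X) w.
Proof.
split=> [h w|h v /frame_spanP [w ->]].
  by rewrite qform_congr; apply: h; apply/frame_spanP; exists w.
by rewrite -/(qform M _) -qform_congr; exact: h.
Qed.

(** An arbitrary source space [T] lets this cover [X], [X^-1] and, on the product, [X^-1 Y]. *)
Lemma measurable_psd_frame_span (disp : measure_display)
    (T : measurableType disp) (M : 'M[R]_m) (X : T -> O) :
  measurable_mx (fun t => orthogonal_mx (X t)) ->
  measurable [set t | psd_on M (frame_span hdm (X t))].
Proof.
move=> mX; pose E t := colsub (widen_ord hdm) (X t).
have mE : measurable_mx E.
  by move=> i j; rewrite /E; under eq_fun do rewrite mxE; exact: mX.
rewrite [X in measurable X](_ : _ =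
    [set t | forall w, 0 <= qform ((E t)^T *m M *m E t) w]); last first.
  by apply/seteqP; split => t /psd_on_frame_span.
apply: measurable_psd; apply: measurable_mx_mul => //.
by apply: measurable_mx_mul; [exact: measurable_mx_tr|exact: measurable_mx_cst].
Qed.

Context (mu : probability O R) (hmu : is_haar mu).

Lemma haar_psd_inv (M : 'M[R]_m) :
  mu [set X : O | psd_on M (frame_span hdm (X^-1)%g)]
  = mu [set X : O | psd_on M (frame_span hdm X)].
Proof.
have mO := @measurable_orthogonal_mx R m.
apply: (haar_inv hmu).
- exact: measurable_psd_frame_span.
- by apply: measurable_psd_frame_span; exact: measurable_mx_tr mO.
- apply: measurable_psd_frame_span; apply: measurable_mx_mul.
    apply: measurable_mx_tr => i j.
    exact: (measurableT_comp (mO i j) measurable_fst).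
  by move=> i j; exact: (measurableT_comp (mO i j) measurable_snd).
Qed.

(** Each diagonal entry is the form [M] at [X] times a column of [B]; as [B] is zero from row [d]
    on, that vector is a combination of the first [d] columns of [X]. *)
Lemma psd_gram_trace_ge0 (M : 'M[R]_m) (X : O) (B : 'M[R]_(m, d)) :
  (forall (i : 'I_m) (j : 'I_d), (d <= i)%N -> B i j = 0) ->
  psd_on M (frame_span hdm X) -> 0 <= \tr (B^T *m (X^T *m M *m X) *m B).
Proof.
move=> B0 hX; apply: sumr_ge0 => j _.
have -> : (B^T *m (X^T *m M *m X) *m B) j j = qform M (X *m col j B).
  rewrite -qform_congr /qform tr_col -row_mul [LHS]mxE [RHS]mxE.
  by apply: eq_bigr => k _; rewrite !mxE.
apply: hX; apply/frame_spanP; exists (\col_k B (widen_ord hdm k) j).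
apply/matrixP => i k; rewrite !mxE (bigID (fun l : 'I_m => (l < d)%N)) /=.
rewrite [X in _ + X]big1 ?addr0 => [|l]; last first.
  by rewrite -leqNgt => dl; rewrite mxE B0 // mulr0.
by rewrite (big_ord_narrow hdm); apply: eq_bigr => l _; rewrite !mxE.
Qed.

Lemma haar_gram_exp_ge (M : 'M[R]_m) (s : R) (G : 'M[R]_(m, d)) : 0 <= s ->
  ((expR (- \tr (G^T *m G)))%:E * mu [set X : O | psd_on M (frame_span hdm X)]
   <= \int[mu]_X (expR (- \tr (G^T *m (X *m (1%:M - s *: M) *m X^T) *m G)))%:E)%E.
Proof.
move=> s0; have mO := @measurable_orthogonal_mx R m.
have [Q oQ B0] := orthogonal_triangularize hdm G.
pose Qo : O := Orthogonal (introT eqP oQ).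
pose B := Q *m G.
pose g (X : O) := (expR (- \tr (B^T *m (X *m (1%:M - s *: M) *m X^T) *m B)))%:E.
(* Substituting [G = Q^T B] moves [Q] onto [X] as a left factor, which Haar invariance then
   removes. *)
have gE (X : O) :
    (expR (- \tr (G^T *m (X *m (1%:M - s *: M) *m X^T) *m G)))%:E = g (Qo * X)%g.
  rewrite /g /B /= !trmx_mul !mulmxA -[G^T *m Q^T *m Q]mulmxA oQ mulmx1.
  by rewrite -[_ *m Q^T *m Q]mulmxA oQ mulmx1.
have mg : measurable_fun setT g.
  apply/measurable_EFinP/measurableT_comp => //; apply: measurableT_comp => //.
  apply: measurable_mx_trace.
  apply: measurable_mx_mul; last exact: measurable_mx_cst.
  apply: measurable_mx_mul; first exact: measurable_mx_cst.
  apply: measurable_mx_mul; last exact: measurable_mx_tr.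
  by apply: measurable_mx_mul => //; exact: measurable_mx_cst.
under eq_integral do rewrite gE.
rewrite (haar_integral hmu Qo mg); last by move=> X; rewrite lee_fin expR_ge0.
have -> : G^T *m G = B^T *m B.
  by rewrite /B trmx_mul mulmxA -[G^T *m Q^T *m Q]mulmxA oQ mulmx1.
set A' := [set X : O | psd_on M (frame_span hdm (X^-1)%g)].
have mA' : measurable A'.
  by apply: measurable_psd_frame_span; exact: measurable_mx_tr mO.
rewrite -haar_psd_inv -/A' -[A']setIT -integral_indic // -ge0_integralZl //=; last first.
  exact/measurable_EFinP/measurable_indic.
(* The comparison is pointwise: off [A'] the left side is 0. On [A'], [X X^T = 1] splits the
   exponent into [- tr(B^T B)] plus [s] times a nonnegative trace. *)
apply: ge0_le_integral => //=.
  by apply: measurable_funeM; exact/measurable_EFinP/measurable_indic.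
move=> X _; rewrite /g indicE; have [|_] := boolP (X \in A'); last first.
  by rewrite mule0 lee_fin expR_ge0.
rewrite inE mule1 lee_fin ler_expR lerN2 => hX.
have tr_ge0 := psd_gram_trace_ge0 B0 hX.
have -> : B^T *m (X *m (1%:M - s *: M) *m X^T) *m B
    = B^T *m B - s *: (B^T *m ((X^-1)%g^T *m M *m (X^-1)%g) *m B).
  rewrite /= trmxK mulmxBr mulmxBl mulmx1 orthogonal_mxK mulmxBr mulmxBl mulmx1.
  by rewrite -!(scalemxAl, scalemxAr).
by rewrite linearB /= linearZ gerBl mulr_ge0.
Qed.

End random_subspace.

(** * Comparison of the two iterated integrals *)

Lemma prod_powR (R : realType) (I : finType) (F : I -> R) (r : R) :
  (forall i, 0 <= F i) -> \prod_i (F i `^ r) = (\prod_i F i) `^ r.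
Proof.
(* Nonnegativity of the partial product is carried along, since it is needed to split the power of a
   product. *)
move=> F0; suff [_ ->] : 0 <= \prod_i F i /\
    \prod_i (F i `^ r) = (\prod_i F i) `^ r by [].
elim/big_rec2 : _ => [|i y1 y2 _ [y0 ->]]; first by rewrite powR1.
by rewrite mulr_ge0 // powRM.
Qed.

Theorem theorem2 (R : realType) (m d : nat) (hd : (1 <= d)%N) (hdm : (d <= m)%N)
    (mu : probability (orthogonal_group R m) R) (hmu : is_haar mu)
    (M : 'M[R]_m) (hM : M^T = M)
    (lam : 'I_m -> R) (hlam : char_poly M = \prod_(i < m) ('X - (lam i)%:P))
    (lmax : R) (hmax_attained : exists i : 'I_m, lam i = lmax)
    (hmax : forall i : 'I_m, lam i <= lmax) (hmax_pos : 0 < lmax)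
    (t : R) (ht0 : 0 < t) (ht : t < 1 / (2 * lmax)) :
  (grassmannian_prob hdm mu [set D : grassmannian R hdm | psd_on M D]
   <= (\prod_(i < m) (1 - 2 * t * lam i) `^ (- (d%:R / 2)))%:E)%E.
Proof.
pose s := 2 * t; have s0 : 0 < s by rewrite mulr_gt0.
have slmax : s * lmax < 1.
  by move: ht; rewrite ltr_pdivlMr ?mulr_gt0 // /s mulrCA mulrA.
have fac_gt0 i : 0 < 1 - s * lam i.
  by rewrite subr_gt0 (le_lt_trans _ slmax) // ler_pM2l.
pose S : 'M[R]_m := 1%:M - s *: M.
have ST : S^T = S by rewrite /S raddfB /= linearZ /= trmx1 hM.
have pS : posdef S by exact: posdef_1B hM hlam hmax (ltW s0) slmax.
have detS : \det S = \prod_(i < m) (1 - s * lam i).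
  by rewrite (det_1B_char_poly _ hlam) // gt_eqF.
change (mu [set X | psd_on M (frame_span hdm X)]
  <= (\prod_(i < m) (1 - s * lam i) `^ (- (d%:R / 2)))%:E)%E.
set A := [set X | _].
have [disp [T [P [G [K [K0 mG intG]]]]]] := gaussian_matrix R m d.
pose f (w : orthogonal_group R m * T) :=
  (expR (- \tr ((G w.2)^T *m (w.1 *m S *m (orthogonal_mx w.1)^T) *m G w.2)))%:E.
have mO := @measurable_orthogonal_mx R m.
have mf : measurable_fun setT f.
  have mX : measurable_mx
      (fun w : orthogonal_group R m * T => orthogonal_mx w.1).
    by move=> i j; exact: (measurableT_comp (mO i j) measurable_fst).
  have mG2 : measurable_mx (fun w : orthogonal_group R m * T => G w.2).
    by move=> i j; exact: (measurableT_comp (mG i j) measurable_snd).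
  apply/measurable_EFinP/measurableT_comp => //; apply: measurableT_comp => //.
  apply: measurable_mx_trace; apply: measurable_mx_mul => //.
  apply: measurable_mx_mul; first exact: measurable_mx_tr.
  apply: measurable_mx_mul; last exact: measurable_mx_tr.
  by apply: measurable_mx_mul => //; exact: measurable_mx_cst.
have f0 w : (0 <= f w)%E by rewrite lee_fin expR_ge0.
have fub := @fubini_tonelli _ _ _ _ R mu P f mf f0.
(* [X S X^T] is positive definite with the determinant of [S], so the inner integral does not depend
   on [X]. *)
have lhs : (\int[mu]_X \int[P]_w f (X, w) = (K / Num.sqrt (\det S) ^+ d)%:E)%E.
  have inner (X : orthogonal_group R m) :
      (\int[P]_w f (X, w) = (K / Num.sqrt (\det S) ^+ d)%:E)%E.
    have oX := orthogonal_mxK X.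
    rewrite /f /= intG.
    - by rewrite !det_mulmx mulrAC -det_mulmx oX det1 mul1r.
    - by rewrite !trmx_mul trmxK ST mulmxA.
    - rewrite -{1}[orthogonal_mx X]trmxK; apply: posdef_congr => //.
      by have [] := mulmx1_unit oX.
  under eq_integral do rewrite inner.
  by rewrite integral_cst // [X in (_ * X)%E](probability_setT mu) mule1.
have rhs : (K%:E * mu A <= \int[P]_w \int[mu]_X f (X, w))%E.
  (* The case [S = 1] identifies [K] as the total Gaussian mass. *)
  have -> : K%:E = (\int[P]_w (expR (- \tr ((G w)^T *m G w)))%:E)%E.
    under eq_integral do rewrite -[(G _)^T]mulmx1.
    rewrite intG ?trmx1 //; last by move=> x x0; exact: qform1_gt0.
    by rewrite det1 sqrtr1 expr1n divr1.
  have mGG : measurable_fun setT (fun w => (expR (- \tr ((G w)^T *m G w)))%:E).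
    apply/measurable_EFinP/measurableT_comp => //; apply: measurableT_comp => //.
    by apply/measurable_mx_trace/measurable_mx_mul => //; exact: measurable_mx_tr.
  rewrite -ge0_integralZr //=; apply: ge0_le_integral => //=.
  - by move=> w _; rewrite mule_ge0 // lee_fin expR_ge0.
  - by apply: emeasurable_funM => //; exact: measurable_cst.
  - exact: measurable_fun_fubini_tonelli_G.
  - by move=> w _; have := haar_gram_exp_ge hdm hmu M (G w) (ltW s0); exact.
rewrite -fub lhs in rhs.
have -> : \prod_(i < m) (1 - s * lam i) `^ (- (d%:R / 2))
    = (Num.sqrt (\det S) ^+ d)^-1.
  rewrite detS -powR12_sqrt; last by rewrite prodr_ge0 // => i _; exact: ltW.
  rewrite -powR_mulrn ?powR_ge0 // -powRrM -powRN mulrC.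
  by rewrite -prod_powR // => i; exact: ltW.
have mA : measurable A := measurable_psd_frame_span hdm M mO.
(* All terms being finite, the inequality passes to the reals, where [K > 0] cancels. *)
move: rhs; rewrite -(@fineK _ (mu A)) ?fin_num_measure // -EFinM !lee_fin.
by rewrite ler_pM2l.
Qed.
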